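(* Let $n\ge 1$. The set of type 2 signed arc permutations, $$\bigcup_{2\le k\le n}\{\,-(k-1)\;\dots\;-1\;\,-n\;\dots\;-k\,\}\ \cup\ \{\,-n\;\dots\;-2\;-1\,\}\subset B_n,$$ is in descent preserving bijection with the set of all standard domino tableaux of shapes $(2n-1,1)$ and $(2n-3,1,1,1)$.
   Context: $B_n$ is the hyperoctahedral group of all permutations $\pi$ of $\{-n,\dots,-1,0,1,\dots,n\}$ with $\pi(-i)=-\pi(i)$ for all $i$; $\pi$ is identified with the word $\pi(1)\cdots\pi(n)$. For $\pi\in B_n$, $Des(\pi)=\{0\le i\le n-1 \mid \pi(i)>\pi(i+1)\}$ (with $\pi(0)=0$). Young diagrams are drawn with left-justified rows, row 1 on top. A standard domino tableau of shape $\lambda$, $\lambda$ a partition of $2n$, is a tiling of the Young diagram of $\lambda$ by $n$ dominoes ($1\times 2$ or $2\times 1$ rectangles) labelled bijectively by $\{1,\dots,n\}$, labels strictly increasing along rows and down columns (comparing distinct dominoes). A standard domino tableau $T$ has a descent in position $i$, $1\le i\le n-1$, if the domino labelled $i+1$ lies strictly below the domino labelled $i$ (all boxes of domino $i+1$ lie in rows strictly lower than all boxes of domino $i$), and has a descent in position $0$ if the domino labelled $1$ is vertical; $Des(T)$ is the set of its descents. If an indicated shape is not a partition (which happens for $(2n-3,1,1,1)$ only when $n=1$), there are no tableaux of that shape. A bijection $f$ from a set of signed permutations to a set of standard domino tableaux is descent preserving if $Des(f(\pi))=Des(\pi)$ for all $\pi$. *)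

(* Defs.v *)
From HB Require Import structures.
From mathcomp Require Import all_boot all_order all_algebra all_fingroup.

Set Implicit Arguments.
Unset Strict Implicit.
Unset Printing Implicit Defensive.

Import Order.TTheory GRing.Theory Num.Theory.

(* The set {-n, ..., 0, ..., n} is encoded by 'I_(2 * n).+1, the ordinal x
   standing for the integer x - n; [rev_ord], which maps x to 2 * n - x, is
   then the negation i |-> -i. *)
Definition hyperoctahedral (n : nat) : {set {perm 'I_(2 * n).+1}} :=
  [set p : {perm 'I_(2 * n).+1} | [forall x, p (rev_ord x) == rev_ord (p x)]].

(* The integer p(i), meaningful for 0 <= i <= n. *)
Definition letter (n : nat) (p : {perm 'I_(2 * n).+1}) (i : nat) : int :=
  ((p (inord (n + i)) : nat)%:Z - n%:Z)%R.

Definition word (n : nat) (p : {perm 'I_(2 * n).+1}) : seq int :=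
  [seq letter p i | i <- iota 1 n].

Definition Des_perm (n : nat) (p : {perm 'I_(2 * n).+1}) : {set 'I_n} :=
  [set i : 'I_n | (letter p i.+1 < letter p i)%R].

(* -(k-1) ... -1 -n ... -k; recall that index_iota a b is a, ..., b - 1. *)
Definition arc_word (n k : nat) : seq int :=
  [seq (- (i%:Z))%R | i <- rev (index_iota 1 k) ++ rev (index_iota k n.+1)].

(* -n ... -2 -1 *)
Definition increasing_word (n : nat) : seq int :=
  [seq (- (i%:Z))%R | i <- rev (index_iota 1 n.+1)].

Definition type2_arc (n : nat) : {set {perm 'I_(2 * n).+1}} :=
  (\bigcup_(2 <= k < n.+1)
     [set p in hyperoctahedral n | word p == arc_word n k])
  :|: [set p in hyperoctahedral n | word p == increasing_word n].

Definition is_partition (sh : seq nat) : bool :=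
  sorted geq sh && (0 \notin sh).

(* A box is a pair (row, column), both numbered from 0. *)
Definition box : Type := (nat * nat)%type.

Definition diagram (sh : seq nat) : seq box :=
  [seq (r, c) | r <- iota 0 (size sh), c <- iota 0 (nth 0 sh r)].

(* The domino ((r, c), v) has (r, c) as its top left box; it is vertical if
   v is true and horizontal otherwise. *)
Definition domino : Type := (box * bool)%type.

Definition vertical (d : domino) : bool := d.2.

Definition boxes (d : domino) : seq box :=
  let: ((r, c), v) := d in
  [:: (r, c); if v then (r.+1, c) else (r, c.+1)].

(* [strictly_below d e]: d lies strictly below e. *)
Definition strictly_below (d e : domino) : bool :=
  allrel (fun a b : box => b.1 < a.1) (boxes d) (boxes e).

(* A labelled family of n dominoes is the tuple listing them by increasing
   label: the domino labelled l, 1 <= l <= n, is the item of index l - 1. *)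
Definition labelled (n : nat) (T : n.-tuple domino) (l : nat) : domino :=
  nth ((0, 0), false) T l.-1.

(* [diagram sh] is duplicate free, so [perm_eq] says both that the dominoes
   are pairwise disjoint and that their union is the diagram. *)
Definition tiles (n : nat) (sh : seq nat) (T : n.-tuple domino) : bool :=
  perm_eq (flatten [seq boxes d | d <- T]) (diagram sh).

(* If some box of the domino of index i is to the left (in the same row) or
   above (in the same column) of some box of another domino, of index j,
   then i < j. *)
Definition increasing_labels (n : nat) (T : n.-tuple domino) : bool :=
  [forall i : 'I_n, forall j : 'I_n, (i != j) ==>
     allrel (fun a b : box =>
               ((a.1 == b.1) && (a.2 < b.2)) || ((a.2 == b.2) && (a.1 < b.1))
               ==> (i < j))
            (boxes (tnth T i)) (boxes (tnth T j))].

Definition is_SDT (n : nat) (sh : seq nat) (T : n.-tuple domino) : bool :=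
  [&& is_partition sh, sumn sh == 2 * n, tiles sh T & increasing_labels T].

Definition Des_tab (n : nat) (T : n.-tuple domino) : {set 'I_n} :=
  [set i : 'I_n | if (i : nat) == 0 then vertical (labelled T 1)
                  else strictly_below (labelled T i.+1) (labelled T i)].

(* For n = 1 the truncated 2 * n - 3 is 0; [:: 0; 1; 1; 1] is not a partition
   and contributes no tableau. *)
Definition two_shapes_SDT (n : nat) (T : n.-tuple domino) : bool :=
  is_SDT [:: 2 * n - 1; 1] T || is_SDT [:: 2 * n - 3; 1; 1; 1] T.

Definition descent_preserving (n : nat) (A : {set {perm 'I_(2 * n).+1}})
    (P : pred (n.-tuple domino))
    (f : {p : {perm 'I_(2 * n).+1} | p \in A} ->
         {T : n.-tuple domino | P T}) : Prop :=
  forall p, Des_tab (val (f p)) = Des_perm (val p).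

(* Main.v *)
Require Import Defs.
From HB Require Import structures.
From mathcomp Require Import all_boot all_order all_algebra all_fingroup.
From mathcomp Require Import zify.

(** Both sides are indexed by [k < n] so that the element of index [k] has
    descent set [{0, k}]. On the permutation side, it is the arc word of
    parameter [k + 1], which for [k = 0] reads [-n ... -1]. On the tableau
    side, the leg of either hook shape forces a vertical domino in the corner,
    hence labelled 1, and in the longer leg a second one below it; the other
    dominoes are horizontal and fill the first row in increasing order, so that
    a tableau is determined by the label of the second vertical domino, if
    any. *)

Set Implicit Arguments.
Unset Strict Implicit.
Unset Printing Implicit Defensive.

(** * Descent sets as indices, and matching two families by them *)

Definition hook_Des (n : nat) (k : 'I_n) : {set 'I_n} :=
  [set i : 'I_n | ((i : nat) == 0) || (i == k)].

(** The index is the largest element of the set. *)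
Lemma hook_Des_inj n : injective (@hook_Des n).
Proof.
move=> j k /setP E; apply: val_inj.
have := E j; have := E k; rewrite !inE !eqxx !orbT -!val_eqE /=; lia.
Qed.

(** The map sends [a i] to [b i]. An index is picked by choice on each side; since [D] is injective,
    the statistic of an element determines its index, so the pick does not matter and the two maps
    are mutually inverse. *)
Lemma exists_bijective_preserving (S T : choiceType) (I : choiceType) (U : Type)
    (A : pred S) (B : pred T) (dS : S -> U) (dT : T -> U) (D : I -> U)
    (a : I -> S) (b : I -> T) :
  injective D ->
  (forall i, A (a i)) -> (forall s, A s -> exists i, s = a i) ->
  (forall i, dS (a i) = D i) ->
  (forall i, B (b i)) -> (forall t, B t -> exists i, t = b i) ->
  (forall i, dT (b i) = D i) ->
  exists f : {s | A s} -> {t | B t},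
    bijective f /\ forall s, dT (val (f s)) = dS (val s).
Proof.
move=> D_inj Aa a_onto aD Bb b_onto bD.
have a_ind (s : {s | A s}) : exists i, val s == a i.
  by have [i ->] := a_onto _ (valP s); exists i.
have b_ind (t : {t | B t}) : exists i, val t == b i.
  by have [i ->] := b_onto _ (valP t); exists i.
pose f s : {t | B t} := Sub (b (xchoose (a_ind s))) (Bb _).
pose g t : {s | A s} := Sub (a (xchoose (b_ind t))) (Aa _).
have fE s i : val s = a i -> val (f s) = b i.
  move=> si /=; congr b; apply: D_inj.
  by rewrite -2!aD -si; move/eqP: (xchooseP (a_ind s)) => <-.
have gE t i : val t = b i -> val (g t) = a i.
  move=> ti /=; congr a; apply: D_inj.
  by rewrite -2!bD -ti; move/eqP: (xchooseP (b_ind t)) => <-.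
exists f; split.
  exists g => [s | t]; apply: val_inj.
    by have [i si] := a_onto _ (valP s); rewrite (gE _ i) ?(fE _ i).
  by have [i ti] := b_onto _ (valP t); rewrite (fE _ i) ?(gE _ i).
by move=> s; have [i si] := a_onto _ (valP s); rewrite (fE _ i) // bD si aD.
Qed.

(** * The arc permutations and their descents *)

Definition arc_index (n k i : nat) : nat :=
  if i < k then k - i else n + k - i.

Lemma arc_index_bounds n k i : 0 < k <= n -> 0 < i <= n ->
  0 < arc_index n k i <= n.
Proof. by rewrite /arc_index; case: ifP; lia. Qed.

(** [arc_index n k] reverses each of the blocks [1..k-1] and [k..n] in place, hence is an
    involution; its values are the absolute values of the letters of [arc_word n k]. *)
Lemma arc_indexK n k i : 0 < k <= n -> 0 < i <= n ->
  arc_index n k (arc_index n k i) = i.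
Proof. by rewrite /arc_index; case: (ltnP i k) => ?; case: ifP; lia. Qed.

Lemma arc_wordE n k : 0 < k <= n ->
  arc_word n k = [seq (- (arc_index n k i)%:Z)%R | i <- iota 1 n].
Proof.
move=> k_n; rewrite /arc_word.
have size_l: size (rev (index_iota 1 k) ++ rev (index_iota k n.+1)) = n.
  by rewrite size_cat !size_rev !size_iota; lia.
apply: (@eq_from_nth _ 0%R) => [|i]; rewrite !size_map size_l ?size_iota // => i_n.
rewrite (nth_map 0) ?size_l // (nth_map 0) ?size_iota // nth_iota //.
rewrite nth_cat size_rev size_iota /arc_index.
case: ifP => i_k; rewrite nth_rev ?size_iota ?nth_iota; try lia.
all: case: ifP => ?; try lia; congr (- _%:Z)%R; lia.
Qed.

Lemma type2_arcP n (p : {perm 'I_(2 * n).+1}) : 0 < n ->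
  reflect (p \in hyperoctahedral n /\ exists k : 'I_n, word p = arc_word n k.+1)
          (p \in type2_arc n).
Proof.
move=> n_gt0; apply: (iffP idP) => [|[p_hyp [k p_word]]]; rewrite inE.
  case/orP => [|]; last first.
    by rewrite inE => /andP[-> /eqP ->]; split=> //; exists (Ordinal n_gt0).
  rewrite big_seq; elim/big_ind: _ => [|A B IHA IHB|k].
  - by rewrite inE.
  - by rewrite inE => /orP[/IHA | /IHB].
  rewrite mem_index_iota inE => k_n /andP[-> /eqP ->]; split=> //.
  have k_lt: k.-1 < n by lia.
  by exists (Ordinal k_lt); rewrite /= prednK //; lia.
have [k0 | k_gt0] := posnP k.
  by apply/orP; right; rewrite inE p_hyp p_word k0 eqxx.
rewrite (bigD1_seq k.+1) ?iota_uniq ?mem_index_iota //=; last first.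
  by case: k k_gt0 {p_word} => /=; lia.
apply/orP; left; rewrite inE; apply/orP; left.
by rewrite inE p_hyp p_word eqxx.
Qed.

Lemma letter_arc n (p : {perm 'I_(2 * n).+1}) k i :
  word p = arc_word n k -> 0 < k <= n -> 0 < i <= n ->
  letter p i = (- (arc_index n k i)%:Z)%R.
Proof.
move=> p_word k_n i_n; move: p_word; rewrite arc_wordE // => /eq_in_map; apply.
by rewrite mem_iota; lia.
Qed.

Lemma hyperoctahedralE n (p : {perm 'I_(2 * n).+1}) x :
  p \in hyperoctahedral n -> (p (rev_ord x) : nat) = 2 * n - p x.
Proof. by rewrite inE => /forallP/(_ x)/eqP -> /=; rewrite subSS. Qed.

(** The ordinal [n] encodes the integer 0, which is its own negative, so its image is too. *)
Lemma letter0 n (p : {perm 'I_(2 * n).+1}) :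
  p \in hyperoctahedral n -> letter p 0 = 0%R.
Proof.
move/(hyperoctahedralE (inord (n + 0))); rewrite /letter.
have -> : rev_ord (inord (n + 0)) = inord (n + 0) :> 'I_(2 * n).+1.
  by apply: val_inj; rewrite /= inordK; lia.
by have := ltn_ord (p (inord (n + 0))); lia.
Qed.

(** The word gives the values at positive integers, [letter0] the one at 0, and oddness those at
    negative integers. *)
Lemma hyperoctahedral_word_inj n :
  {in hyperoctahedral n &, injective (@word n)}.
Proof.
move=> p q p_hyp q_hyp /eq_in_map pq.
have pq_ge (x : 'I_(2 * n).+1) : n <= x -> p x = q x.
  move=> x_ge; apply: val_inj => /=; have x_lt := ltn_ord x.
  have xE: x = inord (n + (x - n)) by apply: val_inj; rewrite /= inordK; lia.
  suff: letter p (x - n) = letter q (x - n) by rewrite /letter -xE; lia.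
  have [-> | x_gt] := posnP (x - n); first by rewrite !letter0.
  by apply: pq; rewrite mem_iota; lia.
apply/permP => x; have [/pq_ge // | x_lt] := leqP n x.
have x_rev : n <= rev_ord x by rewrite /=; lia.
apply: val_inj; rewrite -[x]rev_ordK /= !(hyperoctahedralE (rev_ord x)) //.
by rewrite (pq_ge _ x_rev).
Qed.

(** The odd extension of [i |-> - arc_index n k i], in the encoding that shifts integers by [n]. *)
Definition arc_fun (n k x : nat) : nat :=
  if n < x then n - arc_index n k (x - n)
  else if x < n then n + arc_index n k (n - x) else n.

Lemma arc_fun_lt n (k : 'I_n) x : arc_fun n k.+1 x < (2 * n).+1.
Proof.
have := ltn_ord k; rewrite /arc_fun /arc_index; do ![case: ifP => ?]; lia.
Qed.

(** The map is an involution: applied twice, it changes the sign twice and applies the involution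
    [arc_index] twice to the absolute value. *)
Lemma arc_ord_inj n (k : 'I_n) :
  injective (fun x : 'I_(2 * n).+1 => Ordinal (arc_fun_lt k x)).
Proof.
apply: inv_inj => x; apply: val_inj => /=.
have k_n : 0 < k.+1 <= n by have := ltn_ord k; lia.
have x_le := ltn_ord x; rewrite {2}/arc_fun.
have [n_x | x_n | //] := ltngtP n x; rewrite /arc_fun.
- have x_n : 0 < x - n <= n by lia.
  have := arc_index_bounds k_n x_n; have := arc_indexK k_n x_n.
  move: (arc_index n k.+1 (x - n)) => y yK y_n.
  have -> : (n < n - y) = false by lia.
  have -> : n - y < n by lia.
  rewrite (_ : n - (n - y) = y) ?yK; lia.
- have n_x : 0 < n - x <= n by lia.
  have := arc_index_bounds k_n n_x; have := arc_indexK k_n n_x.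
  move: (arc_index n k.+1 (n - x)) => y yK y_n.
  have -> : n < n + y by lia.
  rewrite (_ : n + y - n = y) ?yK; lia.
- by rewrite ltnn.
Qed.

Definition arc_perm (n : nat) (k : 'I_n) : {perm 'I_(2 * n).+1} :=
  perm (@arc_ord_inj n k).

Lemma arc_perm_hyperoctahedral n (k : 'I_n) : arc_perm k \in hyperoctahedral n.
Proof.
rewrite inE; apply/forallP => x; apply/eqP/val_inj; rewrite !permE /=.
have := ltn_ord k; have := ltn_ord x.
rewrite /arc_fun /arc_index; do ![case: ifP => ?]; lia.
Qed.

Lemma word_arc_perm n (k : 'I_n) : word (arc_perm k) = arc_word n k.+1.
Proof.
rewrite arc_wordE; last by have := ltn_ord k; lia.
apply/eq_in_map => i; rewrite mem_iota /letter permE /= => i_n.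
have := ltn_ord k; rewrite inordK; last lia.
rewrite /arc_fun /arc_index; do ![case: ifP => ?]; lia.
Qed.

Lemma arc_perm_type2 n (k : 'I_n) : arc_perm k \in type2_arc n.
Proof.
apply/type2_arcP; first by have := ltn_ord k; lia.
split; [exact: arc_perm_hyperoctahedral | exists k; exact: word_arc_perm].
Qed.

Lemma type2_arc_perm n (p : {perm 'I_(2 * n).+1}) :
  0 < n -> p \in type2_arc n -> exists k, p = arc_perm k.
Proof.
move=> n_gt0 /(type2_arcP _ n_gt0)[p_hyp [k p_word]]; exists k.
apply: hyperoctahedral_word_inj => //; first exact: arc_perm_hyperoctahedral.
by rewrite word_arc_perm.
Qed.

(** The first letter is negative, whence the descent at 0. Inside each block the letters increase,
    and if [k > 0] the blocks meet at position [k], where -1 is followed by [-n]. *)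
Lemma Des_arc_perm n (k : 'I_n) : Des_perm (arc_perm k) = hook_Des k.
Proof.
apply/setP => i; rewrite !inE.
have k_lt := ltn_ord k; have i_lt := ltn_ord i.
have letE := letter_arc (word_arc_perm k).
rewrite letE //.
have [-> | i_gt0] := posnP i.
  rewrite letter0 ?arc_perm_hyperoctahedral // /arc_index; case: ifP; lia.
rewrite letE /arc_index //; last lia.
rewrite -val_eqE /=; do ![case: ifP => ?]; lia.
Qed.

(** * The hook tableaux and their descents *)

Definition corner : domino := ((0, 0), true).
Definition leg : domino := ((2, 0), true).
Definition flat (c : nat) : domino := ((0, c), false).

(** The corner takes column 0 of the first row, so the horizontal dominoes start in the odd
    columns. *)
Definition flats (a m : nat) : seq domino :=
  [seq flat i.*2.+1 | i <- iota a m].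

(* [k] is the position, counted from 0, of the second vertical domino, and
   [k = 0] means that there is none. *)
Definition hook_tab (n k : nat) : seq domino :=
  corner :: if k is j.+1 then flats 0 j ++ leg :: flats j (n - j.+2)
            else flats 0 n.-1.

Lemma size_hook_tab n k : k < n -> size (hook_tab n k) == n.
Proof.
by case: k => [|k] k_n /=; rewrite ?size_cat /= !size_map !size_iota; lia.
Qed.

Definition hook_tuple (n : nat) (k : 'I_n) : n.-tuple domino :=
  Tuple (size_hook_tab (ltn_ord k)).

Lemma nth_hook_tab n k i : k < n -> 0 < i < n ->
  if i == k then nth (0, 0, false) (hook_tab n k) i = leg
  else exists c, nth (0, 0, false) (hook_tab n k) i = flat c.
Proof.
case: i => // i; case: k => [|k] k_n i_n /=.
  by eexists; rewrite (nth_map 0) ?size_iota; last lia.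
rewrite eqSS nth_cat size_map size_iota; case: ifP => [/eqP -> | i_k].
  by rewrite ltnn subnn.
case: ifP => i_lt; first by eexists; rewrite (nth_map 0) ?size_iota; last lia.
have ->: i - k = (i - k).-1.+1 by lia.
by eexists; rewrite /= (nth_map 0) ?size_iota; last lia.
Qed.

(** A domino of the first row is strictly below nothing, while the leg is strictly below the corner
    and every horizontal domino, so also below whichever precedes it. *)
Lemma Des_hook_tuple n (k : 'I_n) : Des_tab (hook_tuple k) = hook_Des k.
Proof.
apply/setP => i; rewrite !inE; case: ifP => // /negbT i_gt0.
rewrite /labelled /= -[hook_tab n k]/(hook_tab n k).
have i_lt := ltn_ord i; have k_lt := ltn_ord k.
have := @nth_hook_tab n k i k_lt; rewrite lt0n i_gt0 i_lt => /(_ isT).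
rewrite -val_eqE /=; have [ik | ik] := eqVneq (i : nat) k; last first.
  case=> c ->; rewrite /strictly_below /allrel.
  by case: (nth _ _ i.-1) => [[r c1] []] /=; lia.
move=> ->; have [i1 | i1] := posnP i.-1; first by rewrite i1.
have := @nth_hook_tab n k i.-1 k_lt; case: eqP => [|_]; first lia.
by case=> [|c ->] //; lia.
Qed.

(** * The hook tableaux are standard *)

Lemma diagram2 m :
  diagram [:: m.+1; 1] = (0, 0) :: [seq (0, c) | c <- iota 1 m] ++ [:: (1, 0)].
Proof. by []. Qed.

Lemma diagram4 m : diagram [:: m.+1; 1; 1; 1] =
  (0, 0) :: [seq (0, c) | c <- iota 1 m] ++ [:: (1, 0); (2, 0); (3, 0)].
Proof. by []. Qed.

Lemma boxes_flats a m :
  flatten [seq boxes d | d <- flats a m] = [seq (0, c) | c <- iota a.*2.+1 m.*2].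
Proof. by elim: m a => //= m IH a; rewrite IH doubleS. Qed.

(** This is what allows [d] to carry a larger label than [e]. *)
Definition not_before (d e : domino) : bool :=
  allrel (fun a b : box =>
       ~~ ((a.1 == b.1) && (a.2 < b.2) || (a.2 == b.2) && (a.1 < b.1)))
     (boxes d) (boxes e).

(** The implication towards [i < j] is trivial when [i < j], so only pairs in the opposite order
    constrain. The form with [pairwise] passes to sublists and splits along concatenations. *)
Lemma increasing_labelsE n (T : n.-tuple domino) :
  increasing_labels T = pairwise (fun d e => not_before e d) T.
Proof.
apply/forallP/(pairwiseP corner) => [inc i j | pw i].
  rewrite !inE size_tuple => i_n j_n ij.
  have /forallP/(_ (Ordinal i_n)) := inc (Ordinal j_n).
  rewrite -val_eqE /= !(tnth_nth corner) /=.
  have -> /= : j != i by lia.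
  by apply: sub_all => a; apply: sub_all => b; case: (_ || _) => //=; lia.
apply/forallP => j; apply/implyP => ij; rewrite !(tnth_nth corner).
have [lt_ij | ji] := ltnP i j.
  by rewrite /allrel; apply/allP => a _; apply/allP => b _; rewrite implybT.
have := pw j i; rewrite !inE size_tuple !ltn_ord => /(_ isT isT).
rewrite -val_eqE /= in ij; have lt_ji: j < i by lia.
move/(_ lt_ji); rewrite /not_before /allrel.
by apply: sub_all => a; apply: sub_all => b; case: (_ || _).
Qed.

Lemma pairwise_flats a m : pairwise (fun d e => not_before e d) (flats a m).
Proof.
rewrite pairwise_map; apply: sub_pairwise (_ : pairwise ltn _) => [i j|].
  by rewrite /not_before /allrel /=; lia.
by rewrite -sorted_pairwise ?iota_ltn_sorted //; exact: ltn_trans.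
Qed.

(** The leg shares no row or column with the horizontal dominoes, so it may stand anywhere among
    them. *)
Lemma pairwise_hook_tab n k :
  pairwise (fun d e => not_before e d) (hook_tab n k).
Proof.
have flat_after c m (d : domino) : d \in [:: corner; leg] ->
    all (fun e => not_before e d) (flats c m).
  move=> d_in; apply/allP => _ /mapP[i _ ->]; move: d_in; rewrite !inE.
  by case/orP => /eqP ->; rewrite /not_before /allrel /=; lia.
rewrite /hook_tab; case: k => [|k];
  rewrite /= ?flat_after ?inE ?eqxx ?pairwise_flats //.
rewrite all_cat /= !flat_after ?inE ?eqxx //= pairwise_cat /= !pairwise_flats.
rewrite flat_after ?inE ?eqxx // !andbT.
apply/allrelP => d e /mapP[i]; rewrite mem_iota => i_lt ->.
rewrite inE => /orP[/eqP -> | /mapP[j]].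
  by rewrite /not_before /allrel /=; lia.
rewrite mem_iota => j_ge ->; rewrite /not_before /allrel /=; lia.
Qed.

Lemma two_shapes_hook_tuple n (k : 'I_n) : two_shapes_SDT (hook_tuple k).
Proof.
have k_lt := ltn_ord k.
have inc: increasing_labels (hook_tuple k).
  by rewrite increasing_labelsE pairwise_hook_tab.
rewrite /two_shapes_SDT /is_SDT inc !andbT /tiles /= /is_partition /hook_tab.
case: (k : nat) k_lt => [|j] j_lt; apply/orP; [left | right]; apply/and3P; split.
- by rewrite /= !inE; lia.
- by rewrite /=; lia.
- have -> : 2 * n - 1 = (n.-1).*2.+1 by lia.
  rewrite /tiles /= boxes_flats diagram2.
  by apply/seq.permP => P; rewrite double0 /= count_cat /=; lia.
- by rewrite /= !inE; lia.
- by rewrite /=; lia.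
(* Beyond its corner box, the first row consists of the [j] horizontal dominoes listed before the
   leg and the [n - j.+2] listed after it. *)
have -> : 2 * n - 3 = (j + (n - j.+2)).*2.+1 by lia.
rewrite /tiles /= map_cat flatten_cat /=.
rewrite diagram4 doubleD iotaD map_cat !boxes_flats.
by apply/seq.permP => P; rewrite double0 add1n /= !count_cat /= ?count_cat /=; lia.
Qed.

(** * Every tableau of the two shapes is a hook tableau *)

Lemma sorted_flats (cs : seq nat) a m :
  flatten [seq [:: c; c.+1] | c <- cs] = iota a.*2.+1 m.*2 ->
  map flat cs = flats a m.
Proof.
elim: cs a m => [|c cs IH] a [|m] //=; rewrite -doubleS.
by case=> -> _ /IH ->.
Qed.

(* A horizontal domino of the first row precedes another one only if it ends
   before the other starts, so the boxes are listed from left to right. *)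
Lemma row_tilingE (R : seq domino) m :
  perm_eq (flatten [seq boxes d | d <- R]) [seq (0, c) | c <- iota 1 m.*2] ->
  pairwise (fun d e => not_before e d) R -> R = flats 0 m.
Proof.
move=> R_row R_inc.
(* No domino is vertical, as its lower box would leave the first row. *)
have [cs RE] : exists cs, R = map flat cs.
  exists [seq d.1.2 | d <- R]; rewrite -map_comp -[LHS]map_id.
  apply/eq_in_map => -[[r c] v] dR.
  have in_row x : x \in boxes (r, c, v) -> x.1 = 0.
    move=> x_d; have: x \in flatten [seq boxes d | d <- R].
      by apply/flatten_mapP; exists (r, c, v).
    by rewrite (perm_mem R_row) => /mapP[? _ ->].
  have r0 : r = 0 by apply: (in_row (r, c)); rewrite inE eqxx.
  case: v in_row {dR} => in_row; last by rewrite r0.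
  by have /= := in_row (r.+1, c); rewrite !inE eqxx orbT => /(_ isT).
move: R_row R_inc; rewrite {R}RE => R_row R_inc; apply: sorted_flats.
have boxesE : flatten [seq boxes d | d <- map flat cs] =
    [seq (0, c) | c <- flatten [seq [:: c; c.+1] | c <- cs]].
  by rewrite map_flatten -!map_comp.
have {boxesE} cs_perm : perm_eq (flatten [seq [:: c; c.+1] | c <- cs]) (iota 1 m.*2).
  by apply: (@perm_map_inj _ _ (pair 0)) => [c d []|]; rewrite -?boxesE.
apply: (sorted_eq leq_trans anti_leq _ (iota_sorted _ _) cs_perm).
rewrite sorted_pairwise; last exact: leq_trans.
have {R_inc} : pairwise (fun c d => c.+1 <= d) cs.
  move: R_inc; rewrite pairwise_map; apply: sub_pairwise => c d.
  by rewrite /not_before /allrel /=; lia.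
elim: cs {R_row cs_perm} => //= c cs IH /andP[/allP c_le /IH ->].
rewrite leqnSn andbT /=; apply/andP; split.
  by apply/allP => x /flatten_mapP[d /c_le]; rewrite !inE => ? /orP[] /eqP ->; lia.
by apply/allP => x /flatten_mapP[d /c_le]; rewrite !inE => ? /orP[] /eqP ->; lia.
Qed.

(** The corner has a box to the left of each domino of the row and above the leg, so nothing can be
    listed before it. Taking [V] empty or reduced to the leg serves the two shapes. *)
Lemma corner_first (T V R : seq domino) m :
  {subset V <= [:: leg]} -> perm_eq T (corner :: V ++ R) ->
  perm_eq (flatten [seq boxes d | d <- R]) [seq (0, c) | c <- iota 1 m.*2] ->
  pairwise (fun d e => not_before e d) T ->
  exists2 T', T = corner :: T' & perm_eq T' (V ++ R).
Proof.
move=> V_leg T_perm R_row.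
(* This includes [d = corner], whose upper box is above its own lower box. *)
have corner_before d : d \in T -> ~~ not_before corner d.
  rewrite (perm_mem T_perm) inE mem_cat => /or3P[/eqP -> // | /V_leg | dR].
    by rewrite inE => /eqP ->.
  have : (d.1.1, d.1.2) \in flatten [seq boxes d | d <- R].
    by apply/flatten_mapP; exists d => //; case: d {dR} => [[r c] v]; rewrite inE eqxx.
  rewrite (perm_mem R_row) => /mapP[c]; rewrite mem_iota.
  case: d {dR} => [[_ _] v] /= c_gt0 [-> ->].
  by rewrite /not_before /allrel /=; lia.
move=> T_inc; have : corner \in T by rewrite (perm_mem T_perm) inE eqxx.
move=> corner_T; case/path.splitPr: corner_T T_perm T_inc corner_before.
case=> [|d s1] s2 T_perm.
  by move=> _ _; exists s2; rewrite // -(perm_cons corner).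
rewrite /= all_cat /= => /andP[/and3P[_ d_corner _] _] /(_ d).
by rewrite inE eqxx d_corner => /(_ isT).
Qed.

(** The domino covering the bottom box [(b.+1, 0)] can extend neither down nor right, so it extends
    up; removing it leaves a tiling of [E]. *)
Lemma tiling_column_end (T : seq domino) b (E : seq box) :
  (b.+2, 0) \notin E -> (b.+1, 1) \notin E ->
  perm_eq (flatten [seq boxes d | d <- T]) ((b, 0) :: (b.+1, 0) :: E) ->
  exists2 T', perm_eq T ((b, 0, true) :: T') &
              perm_eq (flatten [seq boxes d | d <- T']) E.
Proof.
move=> E_below E_right T_E.
have boxes_E d : d \in T -> {subset boxes d <= [:: (b, 0), (b.+1, 0) & E]}.
  by move=> dT x xd; rewrite -(perm_mem T_E); apply/flatten_mapP; exists d.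
have: (b.+1, 0) \in flatten [seq boxes d | d <- T].
  by rewrite (perm_mem T_E) !inE eqxx orbT.
case/flatten_mapP => d dT b_d.
have dE : d = (b, 0, true).
  move: b_d (boxes_E d dT); case: d {dT} => [[r c] []].
    rewrite !inE => /orP[] /eqP[<- <-] // /(_ (b.+2, 0)).
    rewrite !inE eqxx orbT !xpair_eqE (negbTE E_below) => /(_ isT); lia.
  rewrite !inE => /orP[/eqP[<- <-] | /eqP[] //] /(_ (b.+1, 1)).
  rewrite !inE eqxx orbT !xpair_eqE (negbTE E_right) => /(_ isT); lia.
rewrite {}dE {d b_d} in dT; exists (rem (b, 0, true) T); first exact: perm_to_rem.
rewrite -(perm_cat2l (boxes (b, 0, true))) -(permPr T_E) perm_sym.
exact: (perm_flatten (perm_map boxes (perm_to_rem dT))).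
Qed.

Lemma notin_row r c (s : seq nat) :
  0 < r -> (r, c) \notin [seq (0, c) | c <- s].
Proof. by move=> r_gt0; apply/mapP => -[? _ [r0]]; rewrite r0 in r_gt0. Qed.

Lemma two_shapes_hook n (T : n.-tuple domino) :
  0 < n -> two_shapes_SDT T -> exists k, T = hook_tuple k.
Proof.
move=> n_gt0 /orP[] /and4P[]; rewrite increasing_labelsE /tiles => sh_part _.
  have -> : 2 * n - 1 = (n.-1).*2.+1 by lia.
  rewrite diagram2 => T_row T_inc; exists (Ordinal n_gt0); apply: val_inj => /=.
  have [|||R T_R R_row] :=
    @tiling_column_end T 0 [seq (0, c) | c <- iota 1 n.-1.*2].
  - exact: notin_row.
  - exact: notin_row.
  - apply: (perm_trans T_row); rewrite perm_cons cats1 perm_rcons; exact: perm_refl.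
  have [//|T' T_T' T'_R] := @corner_first T [::] R n.-1 _ T_R R_row T_inc.
  rewrite T_T'; congr (_ :: _); apply: row_tilingE.
    exact: perm_trans (perm_flatten (perm_map boxes T'_R)) R_row.
  by move: T_inc; rewrite T_T' => /andP[].
(* For [n = 1] the truncated first part is 0, which a partition excludes. *)
have n_ge2 : 2 <= n by move: sh_part; rewrite /is_partition !inE; lia.
have -> : 2 * n - 3 = (n.-2).*2.+1 by lia.
rewrite diagram4 => T_row T_inc.
set row := [seq (0, c) | c <- _] in T_row.
(* The first column is peeled from the bottom: first the leg, then the corner. *)
have [|||S T_S S_row] := @tiling_column_end T 2 [:: (0, 0), (1, 0) & row].
- by rewrite !inE /= notin_row.
- by rewrite !inE /= notin_row.
- apply: (perm_trans T_row); apply/seq.permP => P.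
  by rewrite /= count_cat /=; lia.
have [R S_R R_row] :=
  tiling_column_end (notin_row _ _ (ltn0Sn 1)) (notin_row _ _ (ltn0Sn 0)) S_row.
have T_R : perm_eq T (corner :: [:: leg] ++ R).
  apply: (perm_trans T_S); rewrite -(perm_cons leg) in S_R.
  apply: (perm_trans S_R); exact: permEl (perm_catCA [:: leg] [:: corner] R).
have [//|T' T_T' T'_R] := corner_first _ T_R R_row T_inc.
have leg_T' : leg \in T' by rewrite (perm_mem T'_R) inE eqxx.
case/path.splitPr: leg_T' T_T' T'_R => s1 s2 T_T' T'_R.
have s_R : perm_eq (s1 ++ s2) R.
  by rewrite -(perm_cons leg) -(permPr T'_R) -cat1s perm_catCA.
(* Once the leg is dropped, the order of the remaining dominoes is forced. *)
have s_flats : s1 ++ s2 = flats 0 n.-2.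
  apply: row_tilingE.
    exact: perm_trans (perm_flatten (perm_map boxes s_R)) R_row.
  apply: subseq_pairwise T_inc; rewrite T_T'.
  apply: subseq_trans (subseq_cons _ _).
  by rewrite cat_subseq // subseq_cons.
have s1_le : size s1 <= n.-2.
  by have := congr1 size s_flats; rewrite size_cat size_map size_iota; lia.
(* The leg comes after the corner and the dominoes of [s1], which gives its position. *)
have k_lt : (size s1).+1 < n by lia.
exists (Ordinal k_lt); apply: val_inj; rewrite /= T_T'; congr (_ :: _).
have -> : flats 0 (size s1) = s1.
  have := congr1 (take (size s1)) s_flats.
  by rewrite take_size_cat // -map_take take_iota (minn_idPl s1_le).
have := congr1 (drop (size s1)) s_flats.
rewrite drop_size_cat // -map_drop drop_iota => ->.
by rewrite add0n (_ : n.-2 - size s1 = n - (size s1).+2) //; lia.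
Qed.

Theorem proposition8 (n : nat) (hn : 1 <= n) :
  exists f : {p : {perm 'I_(2 * n).+1} | p \in type2_arc n} ->
             {T : n.-tuple domino | two_shapes_SDT T},
    bijective f /\ descent_preserving f.
Proof.
apply: (exists_bijective_preserving (@hook_Des_inj n)
          (@arc_perm_type2 n) _ (@Des_arc_perm n)
          (@two_shapes_hook_tuple n) _ (@Des_hook_tuple n)).
- by move=> p; apply: type2_arc_perm.
- by move=> T; apply: two_shapes_hook.
Qed.
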